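(* Let $n\ge 1$, let $A_n$ be the $n\times n$ Cartan matrix of $\mathfrak{sl}(n+1)$ over $\mathbb{C}$, and let $W_n$ be the $n\times n$ matrix with entries $(W_n)_{ab}=n+1-\max(a,b)$. Let $(m,Q,P)$ be one of the following six triples, where $Q$ and $P$ are $m\times m$ matrices: \begin{enumerate} \item $m=2$, $Q=\begin{pmatrix}1&-1\\-1&0\end{pmatrix}$, $P=-\begin{pmatrix}0&1\\1&1\end{pmatrix}$; \item $m=3$, $Q=\begin{pmatrix}2&-2&0\\-1&0&1\\0&-1&0\end{pmatrix}$, $P=\frac12\begin{pmatrix}1&0&-2\\0&0&-2\\1&2&-2\end{pmatrix}$; \item $m=2$, $Q=\begin{pmatrix}2&-1\\-2&0\end{pmatrix}$, $P=-\frac12\begin{pmatrix}0&1\\2&2\end{pmatrix}$; \item $m=2$, $Q=\begin{pmatrix}2&-2\\-1&0\end{pmatrix}$, $P=-\frac12\begin{pmatrix}0&2\\1&2\end{pmatrix}$; \item $m=3$, $Q=\begin{pmatrix}2&0&-1\\0&2&-1\\-1&-1&0\end{pmatrix}$, $P=\frac14\begin{pmatrix}1&-1&-2\\-1&1&-2\\-2&-2&-4\end{pmatrix}$; \item $m=4$, $Q=\begin{pmatrix}2&0&-1&0\\0&2&-1&0\\-1&-1&0&1\\0&0&-1&0\end{pmatrix}$, $P=\frac12\begin{pmatrix}1&0&0&-1\\0&1&0&-1\\0&0&0&-2\\1&1&2&-2\end{pmatrix}$. \end{enumerate} Let $U$ be the $m\times n$ matrix whose only non-zero entry is $U_{m1}=1$,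 and let $V=U^T$. Then $P=Q^{-1}$, the $(m+n)\times(m+n)$ block matrix $N=\begin{pmatrix}Q&U\\-V&A_n\end{pmatrix}$ is invertible, and \[ N^{-1}=\begin{pmatrix}P-PUW_nVP&-PUW_n\\ W_nVP&W_n\end{pmatrix}=\begin{pmatrix}F&G\\H&W_n\end{pmatrix}, \] where, for $1\le i,j\le m$ and $1\le a,b\le n$, \[ F_{ij}=P_{ij}-n\,P_{im}P_{mj},\qquad G_{ib}=-(n-b+1)P_{im},\qquad H_{aj}=(n-a+1)P_{mj}. \]
   Context: $A_n$ has $2$ on the main diagonal, $-1$ in the positions $(a,b)$ with $|a-b|=1$, and $0$ elsewhere (for $n=1$ it is the matrix $(2)$). The six matrices $N$ (denoted in the paper $B_{1,0,n}$, $B_{1,00,n}$, $C_{1,0,n}$, $B_{2,0,n}$, $D_{2,0,n}$, $D_{2,00,n}$, in the order of the list) are the ''basic'' Cartan matrices of the series $\mathfrak{osp}$ of complex Lie superalgebras. *)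

(* Defs.v *)
From mathcomp Require Import all_boot all_order all_algebra.
From mathcomp Require Import reals complex.

Set Implicit Arguments.
Unset Strict Implicit.
Unset Printing Implicit Defensive.

Import Order.TTheory GRing.Theory Num.Theory.
Local Open Scope ring_scope.

(* Rows and columns are numbered from 0: the entry (a, b) of the 1-based
   convention is the entry with ordinals a - 1 and b - 1, so a 1-based index is
   written a.+1 below. *)

Definition mx_of_rows (K : nzRingType) (m n : nat) (s : seq (seq K)) :
    'M[K]_(m, n) :=
  \matrix_(i < m, j < n) (nth [::] s i)`_j.

Definition cartanA (K : nzRingType) (n : nat) : 'M[K]_n :=
  \matrix_(a < n, b < n)
    if a == b then 2 else if `|a - b|%N == 1%N then -1 else 0.

Definition Wmx (K : nzRingType) (n : nat) : 'M[K]_n :=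
  \matrix_(a < n, b < n) (n.+1%:R - (maxn a.+1 b.+1)%:R).

(* The only non-zero entry is a 1 in the last row and the first column. *)
Definition Umx (K : nzRingType) (m n : nat) : 'M[K]_(m, n) :=
  \matrix_(i < m, j < n) ((i.+1 == m) && (j.+1 == 1%N))%:R.

(* osp_triple Q P, with Q and P of size m.+1, says that (m.+1, Q, P) is one of
   the six triples; the constructors are named after the series of the matrix
   N built from Q.  The size is a successor so that ord_max is the last index. *)
Inductive osp_triple (K : unitRingType) :
    forall m : nat, 'M[K]_m.+1 -> 'M[K]_m.+1 -> Prop :=
| osp_B1_0 : @osp_triple K 1
    (mx_of_rows 2 2 [:: [:: 1; -1];
                        [:: -1; 0]])
    (- mx_of_rows 2 2 [:: [:: 0; 1];
                          [:: 1; 1]])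
| osp_B1_00 : @osp_triple K 2
    (mx_of_rows 3 3 [:: [:: 2; -2; 0];
                        [:: -1; 0; 1];
                        [:: 0; -1; 0]])
    ((1 / 2) *: mx_of_rows 3 3 [:: [:: 1; 0; -2];
                                   [:: 0; 0; -2];
                                   [:: 1; 2; -2]])
| osp_C1_0 : @osp_triple K 1
    (mx_of_rows 2 2 [:: [:: 2; -1];
                        [:: -2; 0]])
    (- (1 / 2) *: mx_of_rows 2 2 [:: [:: 0; 1];
                                     [:: 2; 2]])
| osp_B2_0 : @osp_triple K 1
    (mx_of_rows 2 2 [:: [:: 2; -2];
                        [:: -1; 0]])
    (- (1 / 2) *: mx_of_rows 2 2 [:: [:: 0; 2];
                                     [:: 1; 2]])
| osp_D2_0 : @osp_triple K 2
    (mx_of_rows 3 3 [:: [:: 2; 0; -1];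
                        [:: 0; 2; -1];
                        [:: -1; -1; 0]])
    ((1 / 4) *: mx_of_rows 3 3 [:: [:: 1; -1; -2];
                                   [:: -1; 1; -2];
                                   [:: -2; -2; -4]])
| osp_D2_00 : @osp_triple K 3
    (mx_of_rows 4 4 [:: [:: 2; 0; -1; 0];
                        [:: 0; 2; -1; 0];
                        [:: -1; -1; 0; 1];
                        [:: 0; 0; -1; 0]])
    ((1 / 2) *: mx_of_rows 4 4 [:: [:: 1; 0; 0; -1];
                                   [:: 0; 1; 0; -1];
                                   [:: 0; 0; 0; -2];
                                   [:: 1; 1; 2; -2]]).

(* Main.v *)
Require Import Defs.
From mathcomp Require Import all_boot all_order all_algebra.
From mathcomp Require Import reals complex.
From mathcomp Require Import ring zify.

Set Implicit Arguments.
Unset Strict Implicit.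
Unset Printing Implicit Defensive.

Import Order.TTheory GRing.Theory Num.Theory.
Local Open Scope ring_scope.
Local Open Scope complex_scope.

(** Since [P_mm = -1] in all six cases, the Schur complement of [Q] in [N] is
    [A_n + V P U = A_n - E_11]; it is the inverse of [W_n] because (0-based) column [b] of
    [W_n] is the function [a |-> n - max (a, b)], which vanishes at [a = n] and
    whose discrete second difference is supported at [b].  The formula for the
    inverse of [N] is then block elimination. *)

(** The function lives on all of [nat] because the last row of the Cartan matrix refers to the
    neighbour at index [n]; the factor [(k < n)%:R] records the truncation. *)
Lemma sum_ord_eq (K : nzRingType) (n k : nat) (f : nat -> K) :
  \sum_(j < n) (j == k :> nat)%:R * f j = (k < n)%:R * f k.
Proof.
have [k_lt|k_ge] := ltnP k n.
  rewrite (bigD1 (Ordinal k_lt)) //= eqxx big1 ?addr0 // => j.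
  by rewrite -val_eqE /= => /negPf ->; rewrite mul0r.
rewrite mul0r big1 // => j _.
by rewrite ltn_eqF ?mul0r // (leq_trans (ltn_ord j)).
Qed.

(** Written as indicators in the column index so that [sum_ord_eq] applies. The form [b.+1 == a]
    avoids the truncated predecessor: row 0 has no left neighbour. *)
Lemma cartanA_entry (K : nzRingType) (n : nat) (a b : 'I_n) :
  cartanA K n a b
  = (b == a :> nat)%:R *+ 2 - (b == a.+1 :> nat)%:R - (b.+1 == a)%:R.
Proof.
rewrite mxE -val_eqE /= [in LHS]eq_sym.
have -> : (`|a - b|%N == 1%N) = (b == a.+1 :> nat) || (b.+1 == a) by lia.
case: ltngtP => [b_lt|a_lt|->].
- by rewrite (ltn_eqF (leqW b_lt)) mul0rn subr0 sub0r; case: eqP; rewrite ?oppr0.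
- have -> : (b.+1 == a) = false by lia.
  by rewrite orbF mul0rn sub0r subr0; case: eqP; rewrite ?oppr0.
- have -> : (a == a.+1 :> nat) = false by lia.
  have -> : (a.+1 == a) = false by lia.
  by rewrite !subr0.
Qed.

Lemma cartanA_corner_mul (K : comNzRingType) (n : nat) :
  (cartanA K n - \matrix_(a, b) ((a == 0 :> nat) && (b == 0 :> nat))%:R)
    *m Wmx K n = 1%:M.
Proof.
apply/matrixP => a b; rewrite mxE [RHS]mxE.
pose f (j : nat) : K := n.+1%:R - (maxn j.+1 b.+1)%:R.
have fE (j : nat) : (j <= n)%N -> f j = (n - maxn j b)%:R.
  move=> j_le; have bn := ltn_ord b.
  by rewrite /f maxnSS -natrB ?subSS // ltnS geq_max j_le ltnW.
have fn (j : nat) : (j <= n)%N -> (j < n)%:R * f j = f j.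
  rewrite leq_eqVlt => /orP[/eqP ->|->]; last by rewrite mul1r.
  have bn := ltn_ord b.
  by rewrite ltnn fE // (maxn_idPl (ltnW bn)) subnn mul0r.
transitivity (\sum_(j < n) ((j == a :> nat)%:R * (f j *+ 2)
   - (j == a.+1 :> nat)%:R * f j
   - (j.+1 == a)%:R * f j - (j == 0 :> nat)%:R * ((a == 0 :> nat)%:R * f j))).
  apply: eq_bigr => j _; rewrite mxE cartanA_entry !mxE -/(f j) -mulnb natrM.
  by ring.
rewrite !sumrB (sum_ord_eq _ _ (fun j => f j *+ 2)) !sum_ord_eq.
rewrite (sum_ord_eq _ _ (fun j => _ * f j)) fn // ltn_ord mul1r.
have an := ltn_ord a.
rewrite (leq_ltn_trans _ an) // mul1r.
(* Away from row 0 the product is the second difference of [maxn], which has a kink at [b]. The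
   identity is stated additively in [nat], out of reach of truncated subtraction, and then cast to
   [K]. *)
have f2 j : (j.+2 <= n)%N -> f j.+1 *+ 2 - f j.+2 - f j = (j.+1 == b)%:R.
  move=> jn; rewrite /f.
  have E : ((maxn j.+3 b.+1) + (maxn j.+1 b.+1)
            = (j.+1 == b) + (maxn j.+2 b.+1) * 2)%N by lia.
  have {}E := congr1 (fun x => x%:R : K) E.
  rewrite natrD [RHS]natrD natrM in E.
  by move/(canRL (addrK _)): E => ->; ring.
(* In row 0 the corner lowers the diagonal 2 to 1, leaving the first difference of [f] between 0 and
   1, non-zero only for [b = 0]. *)
case: a an => [[|a] ha] an; rewrite -val_eqE /=.
  rewrite big1 => [|j _]; last by rewrite mul0r.
  rewrite /f mul1r.
  have E : (maxn 2 b.+1 = (0%N == b) + maxn 1 b.+1)%N by lia.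
  by rewrite E natrD; ring.
under eq_bigr do rewrite eqSS.
by rewrite sum_ord_eq (ltnW an) mul1r mul0r subr0 f2.
Qed.

Lemma Umx_mul_corner (K : comNzRingType) (m n : nat) (P : 'M[K]_m.+1) :
  (Umx K m.+1 n)^T *m P *m Umx K m.+1 n
  = P ord_max ord_max *: \matrix_(a, b) ((a == 0 :> nat) && (b == 0 :> nat))%:R.
Proof.
apply/matrixP => a b; rewrite !mxE (bigD1 ord_max) //= big1 ?addr0; last first.
  move=> j; rewrite -val_eqE /= [Umx _ _ _ _ _]mxE eqSS => /negPf -> /=.
  by rewrite mulr0.
rewrite !mxE (bigD1 ord_max) //= big1 ?addr0; last first.
  by move=> j; rewrite -val_eqE /= !mxE eqSS => /negPf -> /=; rewrite mul0r.
rewrite !mxE !eqxx /= !eqSS -mulnb natrM; ring.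
Qed.

(** [Umx] is a matrix unit, so the product has rank at most one: the last column of [P] times the
    first row of [M]. *)
Lemma mul_Umx (K : comNzRingType) (m n p q : nat) (hn : (0 < n)%N)
    (P : 'M[K]_(p, m.+1)) (M : 'M[K]_(n, q)) i b :
  (P *m Umx K m.+1 n *m M) i b = P i ord_max * M (Ordinal hn) b.
Proof.
rewrite -mulmxA mxE (bigD1 ord_max) //= big1 ?addr0; last first.
  move=> j; rewrite -val_eqE /= mxE => /negPf j_neq.
  by rewrite big1 ?mulr0 // => k _; rewrite mxE eqSS j_neq mul0r.
rewrite mxE (bigD1 (Ordinal hn)) //= big1 ?addr0; last first.
  move=> k; rewrite -val_eqE /= => /negPf k_neq.
  by rewrite mxE !eqSS k_neq andbF mul0r.
by rewrite mxE !eqxx mul1r.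
Qed.

Lemma tr_Wmx (K : nzRingType) (n : nat) : (Wmx K n)^T = Wmx K n.
Proof. by apply/matrixP => a b; rewrite !mxE maxnC. Qed.

Lemma mul_tr_Umx (K : comNzRingType) (m n p q : nat) (hn : (0 < n)%N)
    (P : 'M[K]_(m.+1, p)) (M : 'M[K]_(q, n)) a j :
  (M *m (Umx K m.+1 n)^T *m P) a j = M a (Ordinal hn) * P ord_max j.
Proof.
transitivity ((P^T *m Umx K m.+1 n *m M^T)^T a j).
  by rewrite !trmx_mul !trmxK mulmxA.
by rewrite mxE (mul_Umx hn) !mxE mulrC.
Qed.

Lemma Wmx_col0 (K : nzRingType) (n : nat) (hn : (0 < n)%N) (a : 'I_n) :
  Wmx K n a (Ordinal hn) = n%:R - a.+1%:R + 1.
Proof. by rewrite mxE maxnSS maxn0 -[n.+1]addn1 natrD addrAC. Qed.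

Lemma Wmx_row0 (K : nzRingType) (n : nat) (hn : (0 < n)%N) (b : 'I_n) :
  Wmx K n (Ordinal hn) b = n%:R - b.+1%:R + 1.
Proof. by rewrite -tr_Wmx mxE Wmx_col0. Qed.

(** The Schur complement of [Q] carries a plus sign because the lower left block is [- V]. A right
    inverse is enough: for square matrices over a commutative ring it is two-sided. *)
Lemma block_mx_mulV (K : comNzRingType) (m n : nat) (Q P : 'M[K]_m)
    (U : 'M[K]_(m, n)) (V : 'M[K]_(n, m)) (A W : 'M[K]_n) :
  Q *m P = 1%:M -> (A + V *m P *m U) *m W = 1%:M ->
  block_mx Q U (- V) A *m
  block_mx (P - P *m U *m W *m V *m P) (- (P *m U *m W)) (W *m V *m P) W
  = 1%:M.
Proof.
move=> QP SW; rewrite mulmx_block.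
have AW : A *m W = 1%:M - V *m P *m U *m W.
  by rewrite -SW mulmxDl addrK.
rewrite [RHS]scalar_mx_block; congr block_mx.
- by rewrite mulmxBr !mulmxA QP mul1mx subrK.
- by rewrite mulmxN !mulmxA QP mul1mx addNr.
- by rewrite mulNmx !mulmxA AW mulmxBr !mulmxBl mul1mx !mulmxA addNr.
- by rewrite mulNmx mulmxN opprK !mulmxA AW addrC subrK.
Qed.

(** An entrywise check; characteristic zero makes the denominators 2 and 4 invertible. *)
Lemma osp_triple_mulV (K : numFieldType) (m : nat) (Q P : 'M[K]_m.+1) :
  osp_triple Q P -> Q *m P = 1%:M.
Proof.
by case=> {m Q P}; apply/matrixP => i j; rewrite !mxE !big_ord_recl big_ord0;
  case: i => -[|[|[|[|i]]]] hi //; case: j => -[|[|[|[|j]]]] hj //;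
  rewrite !mxE /=; field.
Qed.

(** Besides [Q *m P = 1%:M], this is all that the six cases contribute to the argument. *)
Lemma osp_triple_corner (K : numFieldType) (m : nat) (Q P : 'M[K]_m.+1) :
  osp_triple Q P -> P ord_max ord_max = -1.
Proof. by case=> {m Q P}; rewrite !mxE /=; field. Qed.

Theorem mainTheorem2 (R : realType) (n : nat) (hn : (1 <= n)%N)
    (m : nat) (Q P : 'M[R[i]]_m.+1) (hQP : osp_triple Q P) :
  let A : 'M[R[i]]_n := cartanA _ n in
  let W : 'M[R[i]]_n := Wmx _ n in
  let U : 'M[R[i]]_(m.+1, n) := Umx _ m.+1 n in
  let V : 'M[R[i]]_(n, m.+1) := U^T in
  let N : 'M[R[i]]_(m.+1 + n) := block_mx Q U (- V) A in
  let F : 'M[R[i]]_m.+1 :=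
    \matrix_(i, j) (P i j - n%:R * P i ord_max * P ord_max j) in
  let G : 'M[R[i]]_(m.+1, n) :=
    \matrix_(i, b) (- (n%:R - b.+1%:R + 1) * P i ord_max) in
  let H : 'M[R[i]]_(n, m.+1) :=
    \matrix_(a, j) ((n%:R - a.+1%:R + 1) * P ord_max j) in
  [/\ Q \in unitmx /\ P = invmx Q,
      N \in unitmx,
      invmx N = block_mx (P - P *m U *m W *m V *m P) (- (P *m U *m W))
                         (W *m V *m P) W
    & block_mx (P - P *m U *m W *m V *m P) (- (P *m U *m W))
               (W *m V *m P) W = block_mx F G H W].
Proof.
move=> A W U V N F G H.
have QP := osp_triple_mulV hQP; have Pmm := osp_triple_corner hQP.
have [Qu _] := mulmx1_unit QP.
have PE : P = invmx Q by rewrite -[RHS]mulmx1 -QP mulKmx.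
have SW : (A + V *m P *m U) *m W = 1%:M.
  by rewrite Umx_mul_corner Pmm scaleN1r cartanA_corner_mul.
have NX := block_mx_mulV QP SW; have [Nu _] := mulmx1_unit NX.
split=> //; first by rewrite -[LHS]mulmx1 -NX mulKmx.
congr block_mx; apply/matrixP => i j.
(* The factor [n] in [F] is the top left entry of [W], obtained as [n - 1 + 1]. *)
- rewrite [LHS]mxE [X in _ + X]mxE (mul_tr_Umx hn) (mul_Umx hn) Wmx_col0 mxE.
  by rewrite subrK; congr (_ - _); rewrite [_ * n%:R]mulrC.
- by rewrite mxE (mul_Umx hn) Wmx_row0 /G mxE mulNr mulrC.
- by rewrite (mul_tr_Umx hn) Wmx_col0 /H mxE.
Qed.
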